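(* Let $m$ be an even positive integer, $n$ a positive integer, and let $\mathcal{C}$ be an order $m$ dimension $n$ symmetric Cauchy tensor with generating vector $c\in\mathbb{R}^n$. If $\mathcal{C}$ is positive definite, then the homogeneous polynomial $f(x)=\mathcal{C}x^m$ is strictly monotone increasing in $\mathbb{R}^n_+$.
   Context: $[n]=\{1,\ldots,n\}$, and $\mathbb{R}^n_+$ is the nonnegative orthant of $\mathbb{R}^n$. An order $m$ dimension $n$ symmetric Cauchy tensor with generating vector $c=(c_1,\ldots,c_n)\in\mathbb{R}^n$ is the real tensor $\mathcal{C}=(c_{i_1\cdots i_m})$ with entries $c_{i_1i_2\cdots i_m}=\frac{1}{c_{i_1}+c_{i_2}+\cdots+c_{i_m}}$, $i_1,\ldots,i_m\in[n]$, where it is assumed that $c_{i_1}+\cdots+c_{i_m}\neq 0$ for all $i_1,\ldots,i_m\in[n]$. For an order $m$ dimension $n$ tensor $\mathcal{A}=(a_{i_1\cdots i_m})$ put $\mathcal{A}x^m:=\sum_{i_1,\ldots,i_m\in[n]}a_{i_1\cdots i_m}x_{i_1}\cdots x_{i_m}$; $\mathcal{A}$ is positive definite if $\mathcal{A}x^m> 0$ for all nonzero $x\in\mathbb{R}^n$. For $x,y\in\mathbb{R}^n$, $x\ge y$ means $x_i\ge y_i$ for all $i\in[n]$. A function $f$ is strictly monotone increasing in $X\subseteq\mathbb{R}^n$ if $f(x)> f(y)$ for all $x,y\in X$ with $x\ge y$ and $x\ne y$. *)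

(* Defs.v *)
From HB Require Import structures.
From mathcomp Require Import all_boot all_order all_algebra.
From mathcomp Require Import classical_sets reals.
Set Implicit Arguments.
Unset Strict Implicit.
Unset Printing Implicit Defensive.
Import Order.TTheory GRing.Theory Num.Theory.
Local Open Scope ring_scope.
Local Open Scope classical_set_scope.

(* Order m, dimension n real tensors: the entry a_{i_1...i_m} is [A i], where
   the multi-index (i_1, ..., i_m) is a finite function i : 'I_m -> 'I_n. *)
Definition tensor (R : realType) (m n : nat) := {ffun 'I_m -> 'I_n} -> R.

(* A is the symmetric Cauchy tensor with generating vector c; the first
   conjunct is the standing assumption that makes the entries well defined. *)
Definition is_cauchy_tensor (R : realType) (m n : nat)
    (c : 'rV[R]_n) (A : tensor R m n) : Prop :=
  (forall i : {ffun 'I_m -> 'I_n}, \sum_(k < m) c 0 (i k) != 0) /\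
  (forall i : {ffun 'I_m -> 'I_n}, A i = 1 / \sum_(k < m) c 0 (i k)).

(* The homogeneous polynomial A x^m. *)
Definition tensor_form (R : realType) (m n : nat)
    (A : tensor R m n) (x : 'rV[R]_n) : R :=
  \sum_(i : {ffun 'I_m -> 'I_n}) A i * \prod_(k < m) x 0 (i k).

Definition positive_definite (R : realType) (m n : nat)
    (A : tensor R m n) : Prop :=
  forall x : 'rV[R]_n, x != 0 -> 0 < tensor_form A x.

Definition vec_ge (R : realType) (n : nat) (x y : 'rV[R]_n) : Prop :=
  forall i : 'I_n, y 0 i <= x 0 i.

Definition nonneg_orthant (R : realType) (n : nat) : set 'rV[R]_n :=
  [set x | vec_ge x 0].

Definition strictly_monotone_increasing_in (R : realType) (n : nat)
    (X : set 'rV[R]_n) (f : 'rV[R]_n -> R) : Prop :=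
  forall x y : 'rV[R]_n, X x -> X y -> vec_ge x y -> x <> y -> f y < f x.

(* Main.v *)
(* Evaluating the form at the standard basis vector e_j isolates the diagonal
   entry 1 / (m c_j), so positive definiteness forces c_j > 0.  Hence all the
   coefficients of the form are positive: every monomial is nondecreasing on the
   nonnegative orthant, and the monomial x_j ^ m is strictly increasing in x_j. *)
Require Import Defs.
From mathcomp Require Import all_boot all_order all_algebra.
From mathcomp Require Import classical_sets reals.
Import Order.TTheory GRing.Theory Num.Theory.
Local Open Scope ring_scope.

(** A multi-index other than the constant [j] has a slot [k] with [i k != j], where [delta_mx 0 j]
    contributes a zero factor; only the constant one survives. *)
Lemma tensor_form_delta (R : realType) (m n : nat) (A : tensor R m n)
    (j : 'I_n) :
  tensor_form A (delta_mx 0 j) = A [ffun=> j].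
Proof.
rewrite /tensor_form (bigD1 [ffun=> j]) //= [X in _ * X]big1 => [|k _]; last first.
  by rewrite ffunE mxE !eqxx.
rewrite mulr1 big1 ?addr0 // => i ij.
have [k ikj] : exists k, i k != j.
  apply/existsP; rewrite -negb_forall; apply: contra ij => /forallP ij.
  by apply/eqP/ffunP => k; rewrite ffunE; apply/eqP.
by rewrite (bigD1 k) //= mxE (negPf ikj) andbF mul0r mulr0.
Qed.

Lemma cauchy_generator_gt0 (R : realType) (m n : nat) (c : 'rV[R]_n)
    (C : tensor R m n) :
  is_cauchy_tensor c C -> positive_definite C -> forall j, 0 < c 0 j.
Proof.
move=> [_ CE] Cpd j.
have /Cpd : delta_mx 0 j != 0 :> 'rV[R]_n.
  by apply/eqP => /rowP/(_ j)/eqP; rewrite !mxE !eqxx oner_eq0.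
rewrite tensor_form_delta CE div1r invr_gt0.
under eq_bigr do rewrite ffunE.
rewrite sumr_const card_ord => cm_gt0.
(* Positivity of [c 0 j *+ m] itself excludes [m = 0]. *)
have m_gt0 : (0 < m)%N.
  by rewrite lt0n; apply: contraTneq cm_gt0 => ->; rewrite mulr0n ltxx.
by rewrite pmulrn_lgt0 in cm_gt0.
Qed.

Lemma tensor_form_increasing (R : realType) (m n : nat) (A : tensor R m n) :
  (0 < m)%N -> (forall i, 0 < A i) ->
  strictly_monotone_increasing_in (@nonneg_orthant R n) (tensor_form A).
Proof.
move=> m_gt0 A_gt0 x y _ y_ge0 lexy /eqP neq_xy.
have {}y_ge0 j : 0 <= y 0 j by have := y_ge0 j; rewrite mxE.
have [j ltyx] : exists j, y 0 j < x 0 j.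
  apply/existsP; apply: contraNT neq_xy => /existsPn ge_yx.
  by apply/eqP/rowP => j; apply/le_anti; rewrite lexy leNgt ge_yx.
have lePxy i : A i * \prod_(k < m) y 0 (i k) <= A i * \prod_(k < m) x 0 (i k).
  by rewrite ler_pM2l //; apply: ler_prod => k _; rewrite y_ge0 lexy.
(* The constant multi-index [j] gives the monomial [x_j ^ m], which grows strictly; [lePxy] bounds
   the remaining terms. *)
rewrite /tensor_form (bigD1 [ffun=> j]) //= [ltRHS](bigD1 [ffun=> j]) //=.
apply: ltr_leD; last exact: ler_sum.
rewrite ltr_pM2l //; under eq_bigr do rewrite ffunE.
under [ltRHS]eq_bigr do rewrite ffunE.
by rewrite !prodr_const card_ord ltrXn2r -?lt0n // ltW // (le_lt_trans (y_ge0 j)).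
Qed.

Theorem lemma2p1 (R : realType) (m n : nat) (c : 'rV[R]_n) (C : tensor R m n) :
  (0 < m)%N -> ~~ odd m -> (0 < n)%N ->
  is_cauchy_tensor c C ->
  positive_definite C ->
  strictly_monotone_increasing_in (@nonneg_orthant R n) (tensor_form C).
Proof.
move=> m_gt0 _ _ Ccauchy Cpd; apply: tensor_form_increasing => // i.
have c_gt0 := cauchy_generator_gt0 _ _ _ _ _ Ccauchy Cpd.
have [C_neq0 CE] := Ccauchy.
(* The denominator is nonzero by the Cauchy assumption and nonnegative as a sum of positive
   [c 0 (i k)]. *)
by rewrite CE div1r invr_gt0 lt0r C_neq0 sumr_ge0 // => k _; exact: ltW.
Qed.
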